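(* Let $R$ be an associative algebra with unity over a field $F$ such that the group of units $U(R)$ contains an $\omega$-subgroup. Let $\Delta U$ be the $FC$-radical of $U(R)$, let $t(\Delta U)$ be the subgroup of elements of finite order of $\Delta U$, and let $\nabla(R)$ be the $FC$-subalgebra of $R$. Then: 1. the elements of the commutator subgroup of $t(\Delta U)$ are unipotent and central in $\Delta U$; 2. if all elements of $\nabla(R)$ are algebraic over $F$, then $\Delta U$ is nilpotent of class at most $2$; 3. $\Delta U$ is a solvable group of length at most $3$, and the subgroup $t(\Delta U)$ is nilpotent of class at most $2$.
   Context: $U(R)$ denotes the group of units of $R$. For $a\in R$, $C_{U(R)}(a)=\{u\in U(R)\mid ua=au\}$. The $FC$-radical of $U(R)$ is $\Delta U=\{a\in U(R)\mid [U(R):C_{U(R)}(a)]<\infty\}$, and the $FC$-subring (here an $F$-subalgebra) of $R$ is $\nabla(R)=\{a\in R\mid [U(R):C_{U(R)}(a)]<\infty\}$. By a theorem of B. H. Neumann, the elements of finite order in $\Delta U$ form a normal subgroup $t(\Delta U)$ and $\Delta U/t(\Delta U)$ is torsion-free abelian. An infinite subgroup $H$ of $U(R)$ is called an $\omega$-subgroup if for every $x,y\in R$ with $[x,y]=xy-yx\neq 0$, the left annihilator $\{r\in R\mid r[x,y]=0\}$ contains only finitely many elements of the form $1-h$ with $h\in H$. A unit of $R$ is unipotent if it has the form $1+x$ with $x\in R$ nilpotent. *)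

(* Defs.v *)
From HB Require Import structures.
From mathcomp Require Import all_boot all_order all_algebra.
From mathcomp Require Import mathcomp_extra boolp classical_sets functions.
From mathcomp Require Import cardinality.

Set Implicit Arguments.
Unset Strict Implicit.
Unset Printing Implicit Defensive.

Import GRing.Theory.

Local Open Scope classical_set_scope.

Section Groups.
Variable G : groupType.
Implicit Types A B H : set G.
Local Open Scope group_scope.

Definition subgroup H : Prop :=
  H 1 /\ (forall x y, H x -> H y -> H (x / y)).

Definition generated A : set G := smallest subgroup A.

Definition commutator_subgroup A B : set G :=
  generated [set [~ a, b] | a in A & b in B].

Definition finite_index H : Prop :=
  finite_set (range (fun u : G => [set u * h | h in H])).

Definition center A : set G :=
  [set z | A z /\ (forall x, A x -> x * z = z * x)].

Definition torsion A : set G :=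
  [set u | A u /\ exists n : nat, (0 < n)%N /\ u ^+ n = 1].

(* The series start at index 0 with A itself, so lower_central A c is the term
   usually written gamma_{c+1}(A). *)
Fixpoint lower_central A (n : nat) : set G :=
  if n is m.+1 then commutator_subgroup (lower_central A m) A else A.

Fixpoint derived_series A (n : nat) : set G :=
  if n is m.+1 then
    commutator_subgroup (derived_series A m) (derived_series A m)
  else A.

Definition nilpotent_class_at_most (c : nat) A : Prop :=
  lower_central A c = [set 1].

Definition solvable_length_at_most (l : nat) A : Prop :=
  derived_series A l = [set 1].

End Groups.

(* FinRing.unit_of provides the group of units only when the ring is finite. *)
Section UnitGroup.
Variable R : unitRingType.
Local Open Scope ring_scope.

Inductive units := Units (x : R) of x \is a GRing.unit.

Definition uval (u : units) : R := let: Units x _ := u in x.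

HB.instance Definition _ := [isSub for uval].
HB.instance Definition _ := [Choice of units by <:].

Definition units_one : units := Units (@unitr1 R).
Lemma units_mul_subproof (u v : units) : uval u * uval v \is a GRing.unit.
Proof. by rewrite (unitrMr _ (valP u)) (valP v). Qed.
Definition units_mul (u v : units) : units := Units (units_mul_subproof u v).
Lemma units_inv_subproof (u : units) : (uval u)^-1 \is a GRing.unit.
Proof. by rewrite unitrV (valP u). Qed.
Definition units_inv (u : units) : units := Units (units_inv_subproof u).

Lemma units_mulA : associative units_mul.
Proof. by move=> u v w; apply: val_inj; apply: mulrA. Qed.
Lemma units_mul1 : left_id units_one units_mul.
Proof. by move=> u; apply: val_inj; apply: mul1r. Qed.
Lemma units_mulr1 : right_id units_one units_mul.
Proof. by move=> u; apply: val_inj; apply: mulr1. Qed.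
Lemma units_mulV : left_inverse units_one units_inv units_mul.
Proof. by move=> u; apply: val_inj; apply: (mulVr (valP u)). Qed.
Lemma units_mulrV : right_inverse units_one units_inv units_mul.
Proof. by move=> u; apply: val_inj; apply: (mulrV (valP u)). Qed.

HB.instance Definition _ := isGroup.Build units
  units_mulA units_mul1 units_mulr1 units_mulV units_mulrV.

End UnitGroup.

Section FC.
Variable R : unitRingType.
Local Open Scope ring_scope.

Definition unit_centralizer (a : R) : set (units R) :=
  [set u | uval u * a = a * uval u].

Definition FC_subring : set R :=
  [set a | finite_index (unit_centralizer a)].

Definition FC_radical : set (units R) :=
  [set u | finite_index (unit_centralizer (uval u))].

Definition omega_subgroup (H : set (units R)) : Prop :=
  [/\ subgroup H, infinite_set H &
      forall x y : R, x * y - y * x != 0 ->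
        finite_set ([set r | r * (x * y - y * x) = 0] `&`
                    [set 1 - uval h | h in H])].

Definition nilpotent_elt (x : R) : Prop := exists n : nat, x ^+ n = 0.

Definition unipotent (u : units R) : Prop :=
  exists x : R, nilpotent_elt x /\ uval u = 1 + x.

End FC.

Arguments FC_subring R : clear implicits.
Arguments FC_radical R : clear implicits.

Definition algebraic_elt (F : fieldType) (R : unitAlgType F) (a : R) : Prop :=
  exists2 p : {poly F}, p != 0%R & horner_alg a p = 0%R.

(* Main.v *)
From HB Require Import structures.
Require Import Defs.
From mathcomp Require Import all_boot all_order all_algebra.
From mathcomp Require Import boolp classical_sets cardinality.
From mathcomp Require Import finfield zify.

Set Implicit Arguments.
Unset Strict Implicit.
Unset Printing Implicit Defensive.

Local Open Scope classical_set_scope.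

(** Write N for the FC-subring, t for the set of torsion elements of the
    FC-radical.  The torsion part t turns out to be abelian, and all three
    conclusions follow from this.

    The hypothesis enters through FC_nilpotent_comm: a nilpotent x in N commutes
    with every y in N.  For x of square zero, infinitely many h in the
    omega-subgroup commute with x and y, and the units 1 - x * h give only
    finitely many conjugates of y; so, for some h, infinitely many differences
    h' - h annihilate [x, y].  As
    e * y * (1 - e) has square zero, idempotents of N commute with N too
    (FC_idempotent_comm).

    If the field F is infinite, an element a of R that is algebraic over F
    commutes with every y in N (algebraic_comm): infinitely many a - c are units,
    two of them conjugate y in the same way, and the quotient of these two is a
    nonconstant fractional linear function of a.

    If F is finite, two torsion elements of the FC-radical lie in a finite monoid
    of units (Dietzmann's lemma, torsion_finite_submonoid), whose span A is a
    finite ring of prime characteristic p contained in N.  Its commutators are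
    nilpotent (finite_subring_commutator_nilpotent): otherwise some primitive
    idempotent e, which is central in A, gives a local ring e A whose residue
    ring is a noncommutative finite domain, against Wedderburn's little theorem.
    So each d = [x, y] is nilpotent, hence commutes with x, and
    [x ^ p, y] = p x ^ (p - 1) d = 0; as x differs by a nilpotent from some
    x ^ (p ^ k) with k > 0, it commutes with y
    (finite_subring_commutative).

    Thus t is abelian.  If all elements of N are algebraic, the FC-radical is
    abelian: over an infinite field by algebraic_comm, over a finite one because
    a unit with finitely many powers is torsion.  In general the derived group of
    the FC-radical lies in t (FC_radical_derived), as in Neumann's theorem; the
    commutator of two elements with finitely many conjugates is shown to be
    torsion by a variant of Dietzmann's rewriting argument
    (finite_class_commg_torsion). *)

(** * Pigeonhole *)

Lemma infinite_fiber (T U : Type) (A : set T) (f : T -> U) :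
  infinite_set A -> finite_set (f @` A) ->
  exists2 x, A x & infinite_set [set y | A y /\ f y = f x].
Proof.
move=> infA finfA; apply: contrapT => nofiber; apply: infA.
have -> : A = \bigcup_(c in f @` A) [set y | A y /\ f y = c].
  apply/seteqP; split=> [x Ax|x [_ _ [Ax _]]//].
  by exists (f x); [exists x | split].
apply: bigcup_finite => // _ [x Ax <-]; apply: contrapT => infx.
by apply: nofiber; exists x.
Qed.

Lemma finite_range_repeat (T : Type) (f : nat -> T) :
  finite_set (range f) -> exists m n, (m < n)%N /\ f m = f n.
Proof.
move=> finf; have [//|m _ infm] := infinite_fiber _ finf.
  exact: infinite_nat.
have [n [/= _ fnm] ltmn] : exists2 n, [set y | [set: nat] y /\ f y = f m] n
    & (m < n)%N.
  apply: contrapT => nolarge; apply: infm.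
  apply: (@sub_finite_set _ _ `I_m.+1); last exact: finite_II.
  move=> n fibn /=; rewrite ltnS leqNgt; apply/negP => ltmn.
  by apply: nolarge; exists n.
by exists m, n.
Qed.

Lemma size_le_count (T : eqType) (r w : seq T) N :
  {subset w <= r} -> {in r, forall x, (count_mem x w <= N)%N} ->
  (size w <= size r * N)%N.
Proof.
elim: r w => [|a r IHr] w wr cw.
  by case: w wr {cw} => // x w /(_ x); rewrite inE eqxx => /(_ isT).
rewrite -(count_predC (pred1 a)) /= mulSn leq_add ?cw ?inE ?eqxx //.
rewrite -size_filter IHr // => x; first rewrite mem_filter /= => /andP[xa].
  by move/wr; rewrite inE (negPf xa).
move=> xr; rewrite count_filter; apply: leq_trans (cw x _).
  by apply: sub_count => y /= /andP[].
by rewrite inE xr orbT.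
Qed.

(** * Words over finite sets of conjugates *)

Section Words.
Variable G : groupType.
Implicit Types (S : set G) (x y z s : G) (w : seq G).
Local Open Scope group_scope.

Local Notation prod w := (\prod_(x <- w) x).

Definition word_over S w : Prop := forall x, x \in w -> S x.

Lemma word_over_cons S x w : word_over S (x :: w) <-> S x /\ word_over S w.
Proof.
split=> [wS|[Sx wS] y]; last by rewrite inE => /predU1P[->|/wS].
by split=> [|y yw]; apply: wS; rewrite inE ?eqxx ?yw ?orbT.
Qed.

Lemma finite_words S M :
  finite_set S -> finite_set [set w | (size w <= M)%N /\ word_over S w].
Proof.
move=> finS; elim: M => [|M IHM].
  apply: (@sub_finite_set _ _ [set [::]]); last exact: finite_set1.
  by case=> // x w [].
apply: (@sub_finite_set _ _ ([set [::]] `|`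
    [set x :: w | x in S & w in [set w | (size w <= M)%N /\ word_over S w]])).
  case=> [|x w] [szw]; first by left.
  by move=> /word_over_cons[Sx wS]; right; exists x => //; exists w.
by rewrite finite_setU; split; [exact: finite_set1 | exact: finite_image2].
Qed.

(** Moving one letter s to the front replaces each letter x that it jumps over
    by the conjugate x ^ s, which is again a letter. *)
Lemma word_collect S s k w :
  (forall x y, S x -> S y -> S (x ^ y)) -> S s -> word_over S w ->
  (k <= count_mem s w)%N ->
  exists w', [/\ word_over S w', size w = (k + size w')%N
               & prod w = s ^+ k * prod w'].
Proof.
move=> conjS Ss; elim: w k => [|x w IHw] [|k] wS kw //.
- by exists [::]; rewrite mul1g.
- by exists (x :: w); rewrite mul1g.
have [Sx {}wS] := (word_over_cons _ _ _).1 wS.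
have [eqxs|neqxs] := eqVneq x s.
  have [||w' [w'S szw prw]] := IHw k => //.
    by move: kw; rewrite /= eqxs eqxx.
  exists w'; split; rewrite //= ?szw // big_cons prw eqxs.
  by rewrite expgS mulgA.
have [||w' [w'S szw prw]] := IHw k.+1 => //.
  by move: kw; rewrite /= (negPf neqxs).
exists (x ^ (s ^+ k.+1) :: w'); split; last 1 first.
- by rewrite !big_cons prw mulgA [x * _]conjgC -mulgA.
- apply/word_over_cons; split=> //.
  elim: k.+1 => [|j IHj]; first by rewrite conjg1.
  by rewrite expgSr conjgM; apply: conjS.
- by rewrite /= szw addnS.
Qed.

(** The rewriting behind Dietzmann's lemma: in a long word some letter s occurs
    N times, and these occurrences can be collected into s ^+ N = z.  Taking
    z = 1 gives finiteness of the submonoid generated by S; the general case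
    treats a central cyclic subgroup. *)
Lemma word_reduce S N z :
  finite_set S -> (forall x y, S x -> S y -> S (x ^ y)) ->
  (0 < N)%N -> (forall s, S s -> s ^+ N = z) ->
  exists M, forall w, word_over S w -> exists q w',
    [/\ word_over S w', (size w' <= M)%N, size w = (q * N + size w')%N
      & prod w = z ^+ q * prod w'].
Proof.
move=> /finite_seqP[r Sr] conjS N_gt0 SN; exists (size r * N)%N => w.
have [n] := ubnP (size w); elim: n w => // n IHn w; rewrite ltnS => szw wS.
have [short|long] := leqP (size w) (size r * N).
  by exists 0%N, w; rewrite mul1g.
have [s rs Nsw] : exists2 s, s \in r & (N <= count_mem s w)%N.
  apply: contrapT => rare; move: long; rewrite ltnNge => /negP; apply.
  apply: size_le_count => [x /wS|x rx]; first by rewrite Sr.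
  by rewrite leqNgt; apply/negP => /ltnW Nxw; apply: rare; exists x.
have Ss : S s by rewrite Sr.
have [w' [w'S szw' ->]] := word_collect conjS Ss wS Nsw.
have [||q [u [uS szu szw'u ->]]] := IHn w' => //; first lia.
exists q.+1, u; split=> //; first lia.
by rewrite (SN s) // mulgA expgS.
Qed.

End Words.

(** * Groups with finite conjugacy classes *)

Section FiniteClasses.
Variable G : groupType.
Implicit Types (x y : G).
Local Open Scope group_scope.

Local Notation prod w := (\prod_(x <- w) x).

Definition finite_class x : Prop := finite_set (range (conjg x)).

Lemma finite_powers_torsion x :
  finite_set (range (fun n => x ^+ n)) -> exists n, (0 < n)%N /\ x ^+ n = 1.
Proof.
move=> /finite_range_repeat[m [n [ltmn eqx]]]; exists (n - m)%N.
by rewrite subn_gt0 expgnFr ?(ltnW ltmn) // -eqx mulgV.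
Qed.

Lemma finite_class_commute x y :
  finite_class x -> exists n, (0 < n)%N /\ commute x (y ^+ n).
Proof.
move=> finx; have [|m [n [ltmn eqx]]] :=
    @finite_range_repeat _ (fun n => x ^ (y ^+ n)).
  by apply: sub_finite_set finx => _ [n _ <-]; exists (y ^+ n).
exists (n - m)%N; rewrite subn_gt0; split=> //.
apply/commgP; rewrite -conjg_fix -(inj_eq (@conjg_inj _ (y ^+ m))).
by rewrite -conjgM -expgnDr subnK ?(ltnW ltmn) // eqx.
Qed.

Lemma finite_classV x : finite_class x -> finite_class x^-1.
Proof.
move=> finx; apply: sub_finite_set (finite_image (fun y => y^-1) finx).
by move=> _ [y _ <-]; exists (x ^ y); [exists y | rewrite conjVg].
Qed.

Lemma finite_classM x y :
  finite_class x -> finite_class y -> finite_class (x * y).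
Proof.
move=> finx finy; apply: sub_finite_set (finite_image2 *%g finx finy).
move=> _ [z _ <-]; exists (x ^ z); first by exists z.
by exists (y ^ z); [exists z | rewrite conjMg].
Qed.

(** Dietzmann's lemma for two elements: with z = 1, word_reduce leaves only words
    of bounded length in the conjugates of x and y. *)
Lemma torsion_finite_submonoid x y m n :
  finite_class x -> finite_class y -> (0 < m)%N -> (0 < n)%N ->
  x ^+ m = 1 -> y ^+ n = 1 ->
  exists V : set G, [/\ finite_set V, V 1, V x, V y &
    forall u v, V u -> V v -> V (u * v)].
Proof.
move=> finx finy m_gt0 n_gt0 xm yn.
pose S := range (conjg x) `|` range (conjg y).
have finS : finite_set S by rewrite finite_setU.
have conjS u v : S u -> S v -> S (u ^ v).
  move=> [[a _ <-]|[a _ <-]] _; rewrite -conjgM; [left|right];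
    by exists (a * v).
have SN s : S s -> s ^+ (m * n) = 1.
  move=> [[a _ <-]|[a _ <-]]; rewrite -conjXg.
    by rewrite expgnA xm expg1n conj1g.
  by rewrite mulnC expgnA yn expg1n conj1g.
have [|M redS] := word_reduce finS conjS _ SN; first by rewrite muln_gt0 m_gt0.
exists [set prod w | w in word_over S]; split.
- apply: sub_finite_set (finite_image (fun w => prod w) (finite_words M finS)).
  move=> _ [w wS <-]; have [q [w' [w'S szw' _ ->]]] := redS w wS.
  by exists w' => //; rewrite expg1n mul1g.
- by exists [::]; rewrite ?big_nil.
- exists [:: x]; rewrite ?big_seq1 // => _ /[!inE]/eqP->.
  by left; exists 1; rewrite ?conjg1.
- exists [:: y]; rewrite ?big_seq1 // => _ /[!inE]/eqP->.
  by right; exists 1; rewrite ?conjg1.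
move=> _ _ [u uS <-] [v vS <-]; exists (u ++ v); rewrite ?big_cat //.
by move=> s; rewrite mem_cat => /orP[/uS|/vS].
Qed.

Lemma torsionM x y m n :
  finite_class x -> finite_class y -> (0 < m)%N -> (0 < n)%N ->
  x ^+ m = 1 -> y ^+ n = 1 -> exists k, (0 < k)%N /\ (x * y) ^+ k = 1.
Proof.
move=> finx finy m_gt0 n_gt0 xm yn.
have [V [finV V1 Vx Vy VM]] :=
  torsion_finite_submonoid finx finy m_gt0 n_gt0 xm yn.
apply: finite_powers_torsion; apply: sub_finite_set finV => _ [k _ <-].
by elim: k => [|k IHk]; rewrite ?expg0 // expgS; apply: (VM) => //; apply: (VM).
Qed.

(** Some power z = x ^+ N commutes with y.  The conjugates of x by the
    centralizer of z all have N-th power z.  Up to a power of z, [~ x, y] is a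
    word of length N in these conjugates, hence so is each power of it with
    length a multiple of N; word reduction leaves words of bounded length, and
    the length that remains determines the power of z.  So [~ x, y] has finitely
    many powers. *)
Lemma finite_class_commg_torsion x y :
  finite_class x -> finite_class y ->
  exists k, (0 < k)%N /\ [~ x, y] ^+ k = 1.
Proof.
move=> finx finy.
have [N [N_gt0 cyxN]] := finite_class_commute x finy.
pose z := x ^+ N; pose S := [set x ^ g | g in [set g | commute z g]].
have finS : finite_set S.
  by apply: sub_finite_set finx => _ [g _ <-]; exists g.
have SN s : S s -> s ^+ N = z.
  by move=> [g /commgP/conjg_fixP czg <-]; rewrite -conjXg; apply: czg.
have Sz s : S s -> commute z s.
  by move=> /SN <-; apply/commute_sym/commuteX/commute_refl.
have conjS u v : S u -> S v -> S (u ^ v).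
  move=> [g cg <-] Sv; exists (g * v); last by rewrite conjgM.
  by apply: commuteM => //; apply: Sz.
have Sx : S x by exists 1; rewrite ?conjg1 //; apply: commute1.
have Sxy : S (x ^ y) by exists y => //; apply: commute_sym.
have [M redS] := word_reduce finS conjS N_gt0 SN.
(* [~ x, y] = z^-1 * (x ^+ N.-1 * x ^ y) *)
pose c := nseq N.-1 x ++ [:: x ^ y].
have cS : word_over S c.
  by move=> s; rewrite mem_cat mem_nseq inE => /orP[/andP[_ /eqP->]|/eqP->].
have prodc : prod c = z * [~ x, y].
  rewrite big_cat big_seq1 big_nseq -Monoid.iteropE /commg mulgA; congr (_ * _).
  by apply: (@mulIg _ x); rewrite mulgVK -expgSr prednK.
have czc : commute z [~ x, y].
  by apply: commuteM; [apply/commuteV/Sz | apply: Sz].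
have prodck k : prod (flatten (nseq k c)) = z ^+ k * [~ x, y] ^+ k.
  elim: k => [|k IHk]; first by rewrite big_nil mul1g.
  by rewrite /= big_cat IHk /= prodc -!(expgMn _ czc) expgS.
have ckS k : word_over S (flatten (nseq k c)).
  by elim: k => //= k IHk s; rewrite mem_cat => /orP[/cS|/IHk].
have szck k : size (flatten (nseq k c)) = (k * N)%N.
  elim: k => //= k IHk; rewrite size_cat IHk size_cat size_nseq /= mulSn.
  by rewrite addn1 prednK.
apply: finite_powers_torsion.
apply: sub_finite_set (finite_image
  (fun w => z ^- (size w %/ N) * prod w) (finite_words M finS)).
move=> _ [k _ <-]; have [q [w [wS szw eqsz eqprod]]] := redS _ (ckS k).
exists w => //; move: eqsz eqprod; rewrite szck prodck => eqsz eqprod.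
have eqk : k = (q + size w %/ N)%N.
  by rewrite -(mulnK k N_gt0) eqsz divnMDl.
apply: (@mulgI _ (z ^+ k)); rewrite eqprod {1}eqk expgnDr -!mulgA.
by rewrite mulVKg.
Qed.

Lemma commutator_subgroup_trivial (A B : set G) :
  (forall a b, A a -> B b -> commute a b) ->
  commutator_subgroup A B = [set 1].
Proof.
move=> cAB; apply/seteqP; split; last by move=> _ -> X [[X1 _] _].
apply: smallest_sub; first by split=> // x y -> ->; rewrite invg1 mulg1.
by move=> _ [a Aa [b Bb <-]]; apply/eqP/commgP/cAB.
Qed.

End FiniteClasses.

(** * The FC-subring *)

Section FCSubring.
Variable R : unitRingType.
Implicit Types (a b x y : R) (u v h : units R) (H : set (units R)).
Import GRing.Theory.
Local Open Scope ring_scope.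

(** The left cosets of the centralizer of a correspond to the conjugates of a. *)
Lemma FC_subringP a :
  FC_subring R a <->
  finite_set (range (fun u : units R => uval u * a * (uval u)^-1)).
Proof.
pose c u := uval u * a * (uval u)^-1.
have cE u v : (c u = c (u * v)%g) <-> unit_centralizer a v.
  rewrite /c /= invrM ?(valP u) ?(valP v) // !mulrA; split.
    move=> /(mulIr _) -/(_ (etrans (unitrV _) (valP u))).
    rewrite -!mulrA => /(mulrI (valP u)) eqa.
    by rewrite /unit_centralizer /= {2}eqa !mulrA mulrVK ?(valP v).
  rewrite /unit_centralizer /= -(mulrA _ (uval v)) => ->.
  by rewrite mulrA mulrK ?(valP v).
split=> fin.
  have -> : range c = \bigcup_(B in range
      (fun u => [set (u * h)%g | h in unit_centralizer a])) (c @` B).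
    apply/seteqP; split=> [_ [u _ <-]|_ [_ _ [u _ <-]]]; last by exists u.
    exists [set (u * h)%g | h in unit_centralizer a]; first by exists u.
    exists u => //; exists 1%g; rewrite ?mulg1 //.
    by rewrite /unit_centralizer /= mul1r mulr1.
  apply: bigcup_finite fin _ => _ [u _ <-].
  apply: sub_finite_set (finite_set1 (c u)).
  by move=> _ [_ [v cv <-] <-] /=; rewrite -((cE u v).2 cv).
apply: sub_finite_set (finite_image (fun r => [set v | c v = r]) fin).
move=> _ [u _ <-]; exists (c u); first by exists u.
apply/seteqP; split=> [v /= eqc|_ [v cv <-]] /=; last first.
  by rewrite ((cE u v).2 cv).
by exists (u^-1 * v)%g; [apply/(cE u); rewrite mulVKg | rewrite mulVKg].
Qed.

Lemma FC_subring1 : FC_subring R 1.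
Proof.
apply/FC_subringP; apply: sub_finite_set (finite_set1 1) => _ [u _ <-].
by rewrite mulr1 divrr ?(valP u).
Qed.

Lemma FC_subringB x y :
  FC_subring R x -> FC_subring R y -> FC_subring R (x - y).
Proof.
move=> /FC_subringP finx /FC_subringP finy; apply/FC_subringP.
apply: sub_finite_set (finite_image2 (fun a b => a - b) finx finy).
move=> _ [u _ <-]; exists (uval u * x * (uval u)^-1); first by exists u.
exists (uval u * y * (uval u)^-1); first by exists u.
by rewrite mulrBr mulrBl.
Qed.

Lemma FC_subring0 : FC_subring R 0.
Proof. by rewrite -(subrr 1); apply: FC_subringB; apply: FC_subring1. Qed.

Lemma FC_subringD x y :
  FC_subring R x -> FC_subring R y -> FC_subring R (x + y).
Proof.
move=> Nx Ny; rewrite -[y]opprK; apply: FC_subringB => //.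
by rewrite -sub0r; apply: FC_subringB => //; apply: FC_subring0.
Qed.

Lemma FC_subringM x y :
  FC_subring R x -> FC_subring R y -> FC_subring R (x * y).
Proof.
move=> /FC_subringP finx /FC_subringP finy; apply/FC_subringP.
apply: sub_finite_set (finite_image2 *%R finx finy).
move=> _ [u _ <-]; exists (uval u * x * (uval u)^-1); first by exists u.
exists (uval u * y * (uval u)^-1); first by exists u.
by rewrite !mulrA mulrVK ?(valP u).
Qed.

Lemma FC_subringX x n : FC_subring R x -> FC_subring R (x ^+ n).
Proof.
move=> Nx; elim: n => [|n IHn]; first exact: FC_subring1.
by rewrite exprS; apply: FC_subringM.
Qed.

Lemma FC_radicalP u : FC_radical R u <-> finite_class u.
Proof.
have conjE v : uval (u ^ v)%g = (uval v)^-1 * (uval u * uval v) by [].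
split=> [/FC_subringP|] fin.
  apply: sub_finite_set (finite_image (insubd (1%g : units R)) fin).
  move=> _ [v _ <-]; exists (uval (u ^ v)%g); last first.
    by apply: val_inj; rewrite insubdK //; apply: (valP (u ^ v)%g).
  by exists v^-1%g; rewrite // conjE /= invrK mulrA.
apply/FC_subringP; apply: sub_finite_set (finite_image (@uval R) fin).
move=> _ [v _ <-]; exists (u ^ v^-1)%g; first by exists v^-1%g.
by rewrite conjE /= invrK mulrA.
Qed.

(** Two units conjugate y in the same way exactly when their quotient commutes
    with y: this is how finiteness of the class of y is exploited. *)
Lemma FC_infinite_commute (T : Type) (A : set T) (g : T -> units R) y :
  infinite_set A -> FC_subring R y ->
  exists2 t, A t &
    infinite_set [set s | A s /\ GRing.comm y (uval (g s) / uval (g t))].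
Proof.
move=> infA /FC_subringP finy.
have [|t At inft] := @infinite_fiber _ _ A
    (fun t => uval (g t)^-1%g * y * (uval (g t)^-1%g)^-1) infA.
  by apply: sub_finite_set finy => _ [t _ <-]; exists (g t)^-1%g.
exists t => //; apply: sub_infinite_set inft => s [As] /=; rewrite !invrK.
move=> eqc; split=> //; rewrite /GRing.comm.
have gtU := valP (g t); have gsU := valP (g s).
apply: (mulrI (_ : (uval (g s))^-1 \is a GRing.unit)); first by rewrite unitrV.
apply: (mulIr gtU); rewrite -!mulrA.
rewrite [in RHS]mulKr // [in LHS](mulVr gtU) mulr1.
by rewrite mulrA eqc mulrA.
Qed.

Lemma commute_uval u v : GRing.comm (uval u) (uval v) -> commute u v.
Proof. by move=> cuv; apply: val_inj. Qed.

Lemma FC_radical_derived :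
  commutator_subgroup (FC_radical R) (FC_radical R)
    `<=` torsion (FC_radical R).
Proof.
have NV w : FC_radical R w -> FC_radical R w^-1%g.
  by move=> /FC_radicalP fw; apply/FC_radicalP/finite_classV.
have NM w z : FC_radical R w -> FC_radical R z -> FC_radical R (w * z)%g.
  by move=> /FC_radicalP fw /FC_radicalP fz; apply/FC_radicalP/finite_classM.
apply: smallest_sub.
  split=> [|w z [Nw [m [m_gt0 wm]]] [Nz [n [n_gt0 zn]]]].
    split; last by exists 1%N.
    exact: FC_subring1.
  split; first by apply: NM => //; apply: NV.
  apply: (torsionM _ _ m_gt0 n_gt0 wm); first exact/FC_radicalP.
    exact/FC_radicalP/NV.
  by rewrite expVgn zn invg1.
move=> _ [w Nw [z Nz <-]]; split.
  by apply: (NM); [exact: NV | apply: (NM); [exact: NV | exact: NM]].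
by apply: finite_class_commg_torsion; apply/FC_radicalP.
Qed.

End FCSubring.

(** * Nilpotents and idempotents of the FC-subring *)

Section Omega.
Variable R : unitRingType.
Implicit Types (x y e : R) (u v h : units R) (H : set (units R)).
Import GRing.Theory.
Local Open Scope ring_scope.

Lemma commr_mulB x y d : GRing.comm y (d * x) -> GRing.comm y d ->
  d * (x * y - y * x) = 0.
Proof.
by move=> cydx cyd; rewrite mulrBr !mulrA -cyd -(mulrA y) cydx subrr.
Qed.

Lemma nilpotent_comm_sub x y m n :
  GRing.comm x y -> x ^+ m = 0 -> y ^+ n = 0 -> (x - y) ^+ (m + n) = 0.
Proof.
move=> cxy xm yn; rewrite exprBn_comm // big1 // => -[i /=].
rewrite ltnS => lei _; have [le_ni|lt_in] := leqP n i.
  by rewrite -(subnK le_ni) (exprD y) yn !mulr0 mul0rn.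
have -> : (m + n - i = (n - i) + m)%N by lia.
by rewrite exprD xm !(mulr0, mul0r) mul0rn.
Qed.

Lemma nilpotent_unit x n : x ^+ n = 0 ->
  (1 - x \is a GRing.unit) /\ (1 - x)^-1 = \sum_(i < n) x ^+ i.
Proof.
move=> xn; pose s := \sum_(i < n) x ^+ i.
have E : (1 - x) * s = 1.
  by rewrite -[1 - x]opprB mulNr -subrX1 xn sub0r opprK.
have Es : s * (1 - x) = 1.
  rewrite -[RHS]E; apply: commr_sym; apply: commr_sum => i _.
  exact/commrX/commr_sym/commrB/commr_refl/commr1.
have U : 1 - x \is a GRing.unit by apply/unitrP; exists s.
by split=> //; apply: (mulrI U); rewrite E mulrV.
Qed.

Lemma subgroupV H u : subgroup H -> H u -> H u^-1%g.
Proof. by move=> [H1 HB] Hu; rewrite -div1g; apply: HB. Qed.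

Lemma subgroupM H u v : subgroup H -> H u -> H v -> H (u * v)%g.
Proof.
move=> sgH Hu Hv; rewrite -[v]invgK; apply: sgH.2 => //.
exact: subgroupV.
Qed.

Lemma omega_centralizer H x y :
  subgroup H -> infinite_set H -> FC_subring R x -> FC_subring R y ->
  infinite_set
    [set h | [/\ H h, GRing.comm x (uval h) & GRing.comm y (uval h)]].
Proof.
move=> [_ HB] infH Nx Ny.
have [h Hh infK] := FC_infinite_commute (@id _) infH Nx.
have [k /= [Hk ck] infL] := FC_infinite_commute (@id _) infK Ny.
apply: contra_not infL => finC.
apply: sub_finite_set (finite_image (fun g => g * k)%g finC) => g [[Hg cg] cgk].
exists (g / k)%g; last by rewrite mulgVK.
split=> //=; first exact: HB.
rewrite -[uval g](mulrVK (valP h)) -mulrA; apply: commrM => //.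
rewrite -[X in GRing.comm x X]invrK; apply: commrV.
by rewrite invrM ?unitrV ?(valP h) ?(valP k) // invrK.
Qed.

(** If x ^+ 2 = 0 then 1 - x * h is a unit for each h of the omega-subgroup
    commuting with x and y.  For infinitely many h' this unit conjugates y in the
    same way as for some fixed h, so that h' - h annihilates [x, y] on the left.
    For a general nilpotent x the same works modulo higher powers of x, which
    commute with y by induction. *)
Lemma FC_nilpotent_comm H x y n :
  omega_subgroup H -> FC_subring R x -> FC_subring R y -> x ^+ n = 0 ->
  GRing.comm x y.
Proof.
move=> [sgH infH omegaH] + Ny.
elim: n x => [|n IHn] x Nx xn.
  by move/eqP: xn; rewrite oner_eq0.
have [n0|n_gt0] := posnP n.
  by move: xn; rewrite n0 expr1 => ->; apply: commr_sym; apply: commr0.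
have cyX i : GRing.comm y (x ^+ i.+2).
  apply/commr_sym/IHn; first exact: FC_subringX.
  rewrite -exprM (_ : i.+2 * n = (i.+1 * n + n - n.+1) + n.+1)%N; last by nia.
  by rewrite exprD xn mulr0.
have infC := omega_centralizer sgH infH Nx Ny.
set C := (X in infinite_set X) in infC.
pose g h : units R := insubd (1%g : units R) (1 - x * uval h).
have nilC h : C h -> (x * uval h) ^+ n.+1 = 0.
  by move=> [_ cxh _]; rewrite exprMn_comm // xn mul0r.
have gE h : C h -> uval (g h) = 1 - x * uval h.
  move=> Ch; have [gU _] := nilpotent_unit (nilC h Ch).
  exact: (insubdK (1%g : units R) gU).
have [h Ch infK] := FC_infinite_commute g infC Ny.
apply: contrapT => ncxy.
have {ncxy} d_neq0 : x * y - y * x != 0 by rewrite subr_eq0; apply/eqP.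
have := omegaH x y d_neq0.
apply: contra_not infK => finK.
pose f r : units R := (h * insubd (1%g : units R) (1 - r))%g.
apply: sub_finite_set (finite_image f finK) => k [Ck].
move=> /=; rewrite (gE k Ck) (gE h Ch) (nilpotent_unit (nilC h Ch)).2 => cgk.
have [Hh cxh cyh] := Ch; have [Hk cxk cyk] := Ck.
have czz z i : GRing.comm z (uval h) -> GRing.comm z (uval k) ->
    GRing.comm z ((uval k - uval h) * uval h ^+ i).
  by move=> czh czk; apply: commrM; [apply: commrB | apply: commrX].
exists (1 - uval (h^-1 * k)%g); last first.
  by rewrite /f subKr valKd mulVKg.
split; last first.
  by exists (h^-1 * k)%g => //; apply: subgroupM => //; apply: subgroupV.
have -> : 1 - uval (h^-1 * k)%g = - (uval h)^-1 * (uval k - uval h).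
  by rewrite mulrBr !mulNr opprK mulVr ?(valP h) // addrC.
rewrite /= -mulrA commr_mulB ?mulr0 //; last exact: commrB.
have xk1 : 1 - x * uval k = 1 - x * uval h - x * (uval k - uval h).
  by rewrite mulrBr opprB addrA addrNK.
have [hU hV] := nilpotent_unit (nilC h Ch).
have : GRing.comm y
    (x * (uval k - uval h) * \sum_(i < n.+1) (x * uval h) ^+ i).
  rewrite -[X in GRing.comm y X](subKr 1).
  rewrite -[X in 1 - (X - _)](mulrV hU) hV -mulrBl -xk1.
  by apply: commrB => //; apply: commr1.
(* All terms of the geometric series but the first involve x ^+ 2 or higher. *)
rewrite mulr_sumr big_ord_recl expr0 mulr1 => cS.
have xkh : x * (uval k - uval h) = (uval k - uval h) * x := commrB cxk cxh.
rewrite xkh in cS.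
rewrite -[X in GRing.comm y X](addrK (\sum_(i < n)
  (uval k - uval h) * x * (x * uval h) ^+ bump 0 i)).
have cT (i : 'I_n) :
    GRing.comm y ((uval k - uval h) * x * (x * uval h) ^+ bump 0 i).
  rewrite exprMn_comm // mulrA -[_ * x * _]mulrA -exprS.
  have cXd : GRing.comm (x ^+ i.+2) (uval k - uval h).
    exact/commr_sym/commrX/commr_sym/commrB.
  rewrite -cXd -mulrA.
  by apply: commrM; [apply: cyX | apply: czz].
apply: commrB; last by apply: commr_sum => i _; apply: cT.
exact: cS.
Qed.

(** Both e * y * (1 - e) and (1 - e) * y * e have square zero, so they commute
    with the idempotents e and 1 - e, hence vanish. *)
Lemma FC_idempotent_comm H e y :
  omega_subgroup H -> FC_subring R e -> FC_subring R y -> e * e = e ->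
  GRing.comm e y.
Proof.
move=> omegaH Ne Ny ee.
have N1e : FC_subring R (1 - e) := FC_subringB (FC_subring1 R) Ne.
have zero_prod a b z : a * b = 0 -> b * a = 0 -> FC_subring R a ->
    FC_subring R b -> FC_subring R z -> b * b = b -> a * z * b = 0.
  move=> ab ba Na Nb Nz bb.
  have Nazb : FC_subring R (a * z * b) by do 2?apply: FC_subringM.
  have azb2 : (a * z * b) ^+ 2 = 0.
    by rewrite expr2 -!mulrA (mulrA b) ba !(mul0r, mulr0).
  have := FC_nilpotent_comm omegaH Nazb Nb azb2.
  rewrite /GRing.comm -[a * z * b * b]mulrA bb => ->.
  by rewrite !mulrA ba !mul0r.
have e1e : e * (1 - e) = 0 by rewrite mulrBr mulr1 ee subrr.
have e1e' : (1 - e) * e = 0 by rewrite mulrBl mul1r ee subrr.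
have ee1 : (1 - e) * (1 - e) = 1 - e by rewrite mulrBl mul1r e1e subr0.
have := zero_prod _ _ _ e1e e1e' Ne N1e Ny ee1.
have := zero_prod _ _ _ e1e' e1e N1e Ne Ny ee.
rewrite mulrBl mul1r mulrBl => /eqP; rewrite subr_eq0 => /eqP ye.
rewrite mulrBr mulr1 => /eqP; rewrite subr_eq0 => /eqP ey.
by rewrite /GRing.comm ey ye.
Qed.

End Omega.

(** * Finite rings modulo a completely prime ideal *)

Section ResidueRing.
Import GRing.Theory.
Local Open Scope ring_scope.

(** Wedderburn's little theorem; inverses are found by finite search. *)
Lemma finite_domain_commutative (Q : finNzRingType) :
  (forall x y : Q, x * y = 0 -> x = 0 \/ y = 0) -> @commutative Q Q *%R.
Proof.
move=> domQ.
pose unit (x : Q) := [exists y : Q, (y * x == 1) && (x * y == 1)].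
pose inv (x : Q) : Q :=
  odflt x [pick y | (y * x == 1) && (x * y == 1)].
have invP x : unit x -> inv x * x = 1 /\ x * inv x = 1.
  rewrite /inv; case: pickP => [y /andP[/eqP-> /eqP->] //|none].
  by move=> /existsP[y]; rewrite none.
have unitI x y : y * x = 1 /\ x * y = 1 -> unit x.
  by move=> [yx xy]; apply/existsP; exists y; rewrite yx xy !eqxx.
have invN : {in [predC unit], inv =1 id}.
  move=> x /existsP nx; rewrite /inv; case: pickP => // y yP.
  by case: nx; exists y.
pose QU : finUnitRingType := HB.pack Q (GRing.NzRing_hasMulInverse.Build Q
  (fun x ux => (invP x ux).1) (fun x ux => (invP x ux).2) unitI invN).
apply: (@finDomain_mulrC QU) => x y /domQ[->|->]; first by rewrite eqxx.
by rewrite eqxx orbT.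
Qed.

(** A finite subring elts of R, as a list, with a completely prime ideal of it.
    Bundling the proofs lets the residue ring carry its canonical structures. *)
Record prime_residue (R : nzRingType) := PrimeResidue {
  elts : seq R;
  ideal : {pred R};
  elts1 : 1 \in elts;
  eltsB : {in elts &, forall x y, x - y \in elts};
  eltsM : {in elts &, forall x y, x * y \in elts};
  ideal0 : 0 \in ideal;
  idealB : {in ideal &, forall x y, x - y \in ideal};
  idealMl : {in elts & ideal, forall x y, x * y \in ideal};
  idealMr : {in ideal & elts, forall x y, x * y \in ideal};
  ideal1 : 1 \notin ideal;
  ideal_prime : {in elts &, forall x y,
    x * y \in ideal -> (x \in ideal) || (y \in ideal)}
}.

Variables (R : nzRingType) (K : prime_residue R).
Implicit Types x y : R.

Let elts0 : 0 \in elts K.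
Proof. by rewrite -(subrr 1) eltsB ?elts1. Qed.

Let eltsN x : x \in elts K -> - x \in elts K.
Proof. by move=> xA; rewrite -sub0r eltsB. Qed.

Let eltsD x y : x \in elts K -> y \in elts K -> x + y \in elts K.
Proof. by move=> xA yA; rewrite -[y]opprK eltsB ?eltsN. Qed.

Let idealN x : x \in ideal K -> - x \in ideal K.
Proof. by move=> xP; rewrite -sub0r idealB ?ideal0. Qed.

Let idealD x y : x \in ideal K -> y \in ideal K -> x + y \in ideal K.
Proof. by move=> xP yP; rewrite -[y]opprK idealB ?idealN. Qed.

(** The first element of the list congruent to x; the default x is only reached
    when x is not in elts. *)
Definition representative x : R :=
  head x [seq y <- elts K | x - y \in ideal K].

Definition residue : Type := seq_sub (map representative (elts K)).

HB.instance Definition _ := Finite.on residue.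

Definition residue_class x : residue :=
  insubd (SeqSub (map_f representative (elts1 K)) : residue) (representative x).

Local Notation pi := residue_class.

Let representativeP x : x \in elts K ->
  representative x \in elts K /\ x - representative x \in ideal K.
Proof.
move=> xA; rewrite /representative.
have : x \in [seq y <- elts K | x - y \in ideal K].
  by rewrite mem_filter subrr ideal0.
case E : [seq y <- _ | _] => [//|y s] _ /=.
have : y \in [seq y <- elts K | x - y \in ideal K] by rewrite E mem_head.
by rewrite mem_filter => /andP[].
Qed.

Let val_pi x : x \in elts K -> val (pi x) = representative x.
Proof. by move=> xA; apply: insubdK; apply: map_f. Qed.

Let eq_pi x y : x \in elts K -> y \in elts K ->
  x - y \in ideal K <-> pi x = pi y.
Proof.
move=> xA yA; have [rxA xrx] := representativeP xA.
have [ryA yry] := representativeP yA.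
split=> [xy|/(congr1 val)]; last first.
  rewrite !val_pi // => erxy.
  have -> : x - y = x - representative x - (y - representative y).
    by rewrite erxy opprB addrA addrNK.
  exact: idealB.
apply: val_inj; rewrite !val_pi // /representative.
have -> : [seq z <- elts K | x - z \in ideal K] =
          [seq z <- elts K | y - z \in ideal K].
  apply: eq_filter => z; apply/idP/idP => [xz|yz].
    by rewrite -(subrKA x) -[y - x]opprB idealD ?idealN.
  by rewrite -(subrKA y) idealD.
case E : [seq z <- _ | _] => [|//].
have : y \in [seq z <- elts K | y - z \in ideal K].
  by rewrite mem_filter subrr ideal0.
by rewrite E.
Qed.

Let val_elts (q : residue) : val q \in elts K.
Proof. by have /mapP[x xA ->] := valP q; have [] := representativeP xA. Qed.

Let pi_val (q : residue) : pi (val q) = q.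
Proof.
have /mapP[x xA qx] := valP q; have [rxA xrx] := representativeP xA.
apply: val_inj; rewrite -[RHS]/(val q) qx -[RHS](val_pi xA); congr val.
by apply/eq_pi => //; rewrite -[_ - _]opprB idealN.
Qed.

Let pi_eq x : x \in elts K -> x - val (pi x) \in ideal K.
Proof. by move=> xA; rewrite val_pi //; have [] := representativeP xA. Qed.

Definition residue_add (q r : residue) := pi (val q + val r).
Definition residue_mul (q r : residue) := pi (val q * val r).
Definition residue_opp (q : residue) := pi (- val q).

Let piD x y : x \in elts K -> y \in elts K ->
  residue_add (pi x) (pi y) = pi (x + y).
Proof.
move=> xA yA; apply/eq_pi; rewrite ?eltsD // -[_ - _]opprB idealN //.
by rewrite opprD addrACA idealD ?pi_eq.
Qed.

Let piN x : x \in elts K -> residue_opp (pi x) = pi (- x).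
Proof.
move=> xA; apply/eq_pi; rewrite ?eltsN // opprK addrC.
exact: pi_eq.
Qed.

Let piM x y : x \in elts K -> y \in elts K ->
  residue_mul (pi x) (pi y) = pi (x * y).
Proof.
move=> xA yA; apply/eq_pi; rewrite ?eltsM // -[_ - _]opprB idealN //.
have -> : x * y - val (pi x) * val (pi y)
    = (x - val (pi x)) * y + val (pi x) * (y - val (pi y)).
  by rewrite mulrBl mulrBr addrA addrNK.
by apply: idealD; [apply: idealMr | apply: idealMl]; rewrite ?pi_eq ?val_elts.
Qed.

Let residue_addA : associative residue_add.
Proof.
move=> q r s; rewrite -(pi_val q) -(pi_val r) -(pi_val s).
by rewrite !piD ?eltsD // addrA.
Qed.

Let residue_addC : commutative residue_add.
Proof. by move=> q r; rewrite /residue_add addrC. Qed.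

Let residue_add0 : left_id (pi 0) residue_add.
Proof. by move=> q; rewrite -(pi_val q) piD // add0r. Qed.

Let residue_addN : left_inverse (pi 0) residue_opp residue_add.
Proof. by move=> q; rewrite -(pi_val q) piN // piD ?eltsN // addNr. Qed.

Let residue_mulA : associative residue_mul.
Proof.
move=> q r s; rewrite -(pi_val q) -(pi_val r) -(pi_val s).
by rewrite !piM ?eltsM // mulrA.
Qed.

Let residue_mul1 : left_id (pi 1) residue_mul.
Proof. by move=> q; rewrite -(pi_val q) piM ?elts1 // mul1r. Qed.

Let residue_mulr1 : right_id (pi 1) residue_mul.
Proof. by move=> q; rewrite -(pi_val q) piM ?elts1 // mulr1. Qed.

Let residue_mulDl : left_distributive residue_mul residue_add.
Proof.
move=> q r s; rewrite -(pi_val q) -(pi_val r) -(pi_val s).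
by rewrite !(piD, piM) ?eltsM ?eltsD // mulrDl.
Qed.

Let residue_mulDr : right_distributive residue_mul residue_add.
Proof.
move=> q r s; rewrite -(pi_val q) -(pi_val r) -(pi_val s).
by rewrite !(piD, piM) ?eltsM ?eltsD // mulrDr.
Qed.

Let residue_1neq0 : pi 1 != pi 0.
Proof.
apply/eqP => /eq_pi; rewrite subr0 elts1 => /(_ isT elts0).
by apply/negP/ideal1.
Qed.

HB.instance Definition _ := GRing.isNzRing.Build residue
  residue_addA residue_addC residue_add0 residue_addN residue_mulA
  residue_mul1 residue_mulr1 residue_mulDl residue_mulDr residue_1neq0.

Lemma prime_residue_commutator :
  {in elts K &, forall x y, x * y - y * x \in ideal K}.
Proof.
move=> x y xA yA; apply/eq_pi; rewrite ?eltsM // -!piM //.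
apply: (@finite_domain_commutative residue) => q r qr0.
have : val q * val r \in ideal K.
  rewrite -[_ * _]subr0; by apply/eq_pi => //; apply: eltsM.
case/(ideal_prime (val_elts q) (val_elts r))/orP => [qP|rP]; [left|right].
  by rewrite -(pi_val q); apply/eq_pi; rewrite ?subr0.
by rewrite -(pi_val r); apply/eq_pi; rewrite ?subr0.
Qed.

End ResidueRing.

(** * Finite subrings of the FC-subring *)

Section FiniteSubring.
Variable R : unitRingType.
Implicit Types (x y e f g : R).
Import GRing.Theory.
Local Open Scope ring_scope.

Lemma finite_powers_idempotent x :
  finite_set (range (fun n => x ^+ n)) ->
  exists2 m, (0 < m)%N & x ^+ m * x ^+ m = x ^+ m.
Proof.
move=> /finite_range_repeat[i [j [ltij eqx]]].
have per k a : (i <= a)%N -> x ^+ (a + k * (j - i)) = x ^+ a.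
  move=> leia; elim: k => [|k IHk]; first by rewrite addn0.
  rewrite -[RHS]IHk.
  have -> : (a + k.+1 * (j - i) = j + (a + k * (j - i) - i))%N by nia.
  rewrite exprD -eqx -exprD; congr (_ ^+ _); nia.
(* a multiple of the period j - i beyond the preperiod i *)
exists (i.+1 * (j - i))%N; first by rewrite muln_gt0 subn_gt0.
by rewrite -exprD per // (leq_trans (leqnSn i)) // leq_pmulr ?subn_gt0.
Qed.

Lemma commutator_exprS x y n :
  GRing.comm x (x * y - y * x) ->
  x ^+ n.+1 * y = y * x ^+ n.+1 + x ^+ n * (x * y - y * x) *+ n.+1.
Proof.
set d := x * y - y * x => cxd.
have xy : x * y = y * x + d by rewrite addrC subrK.
elim: n => [|n IHn]; first by rewrite !expr1 xy mul1r.
rewrite exprS -mulrA IHn mulrDr mulrA xy mulrDl -mulrA -exprS -addrA.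
congr (_ + _); rewrite mulrnAr mulrA -exprS [in RHS]mulrS; congr (_ + _).
by rewrite -(commrX n.+1 (commr_sym cxd)).
Qed.

Lemma pchar_comm_sub_expr p k x y :
  p \in [pchar R] -> GRing.comm x y ->
  (x - y) ^+ (p ^ k) = x ^+ (p ^ k) - y ^+ (p ^ k).
Proof.
move=> pR cxy; elim: k => [|k IHk]; first by rewrite !expr1.
rewrite expnSr !exprM IHk -!(pFrobenius_autE pR) pFrobenius_autB_comm //.
exact/commrX/commr_sym/commrX/commr_sym.
Qed.

(** When l lists all idempotents of A, e is primitive.  The members g of l are
    treated one after the other, replacing e by e * g unless this is 0. *)
Lemma idempotent_refine (A : set R) f (l : seq R) :
  (forall x y, A x -> A y -> A (x * y)) ->
  (forall e x, A e -> e * e = e -> A x -> GRing.comm e x) ->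
  (forall g, g \in l -> A g /\ g * g = g) ->
  A f -> f * f = f -> f != 0 ->
  exists e, [/\ A e, e * e = e, e != 0, e * f = e &
    forall g, g \in l -> e * g = e \/ e * g = 0].
Proof.
move=> AM idC + Af ff f_neq0; elim: l => [|g l IHl] lA; first by exists f.
have [|e [Ae ee e_neq0 ef el]] := IHl.
  by move=> h lh; apply: lA; rewrite inE lh orbT.
have [Ag gg] : A g /\ g * g = g by apply: lA; rewrite mem_head.
have [eg0|eg_neq0] := eqVneq (e * g) 0.
  by exists e; split=> // h; rewrite inE => /predU1P[->|/el //]; right.
have ceg : e * g = g * e := idC _ _ Ae ee Ag.
exists (e * g); split=> //; first exact: AM.
- by rewrite {2}ceg mulrA -(mulrA e) gg ceg -mulrA ee.
- by rewrite ceg -mulrA ef.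
move=> h; rewrite inE => /predU1P[->|/el elh]; first by left; rewrite -mulrA gg.
by rewrite ceg -mulrA; case: elh => ->; [left | right; rewrite mulr0].
Qed.

Variables (H : set (units R)) (A : set R).
Hypotheses (omegaH : omega_subgroup H) (finA : finite_set A).
Hypotheses (A1 : A 1) (AB : forall x y, A x -> A y -> A (x - y)).
Hypotheses (AM : forall x y, A x -> A y -> A (x * y)).
Hypothesis AN : A `<=` FC_subring R.

Let AX x n : A x -> A (x ^+ n).
Proof. by move=> Ax; elim: n => [|n IHn] //; rewrite exprS; apply: AM. Qed.

Let nil_comm x y : nilpotent_elt x -> A x -> A y -> GRing.comm x y.
Proof.
by move=> [n xn] Ax Ay; apply: (FC_nilpotent_comm omegaH _ _ xn); apply: AN.
Qed.

Let nilM x y : A x -> A y -> nilpotent_elt x -> nilpotent_elt (x * y).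
Proof.
move=> Ax Ay nx; have cxy := nil_comm nx Ax Ay.
by have [n xn] := nx; exists n; rewrite exprMn_comm // xn mul0r.
Qed.

Let id_comm e x : A e -> e * e = e -> A x -> GRing.comm e x.
Proof.
by move=> Ae ee Ax; apply: (FC_idempotent_comm omegaH) => //; apply: AN.
Qed.

Let power_idempotent x :
  A x -> exists2 m, (0 < m)%N & x ^+ m * x ^+ m = x ^+ m.
Proof.
move=> Ax; apply: finite_powers_idempotent.
by apply: sub_finite_set finA => _ [n _ <-]; apply: AX.
Qed.

(** If d = [x, y] is not nilpotent, some power of d is a nonzero idempotent; let
    e be a primitive idempotent below it.  Idempotents being central, the
    elements u with e * u nilpotent form a completely prime ideal, so Wedderburn
    makes the quotient commutative and e * d nilpotent, although some power of
    e * d is e. *)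
Lemma finite_subring_commutator_nilpotent x y :
  A x -> A y -> nilpotent_elt (x * y - y * x).
Proof.
move=> Ax Ay; set d := x * y - y * x.
have Ad : A d by apply: AB; apply: AM.
have [m m_gt0 dm] := power_idempotent Ad.
have [d0|dm_neq0] := eqVneq (d ^+ m) 0; first by exists m.
have [s sA] := (finite_seqP _).1 finA.
have memA z : (z \in s) = `[<A z>] by apply/idP/asboolP; rewrite sA.
have sP z : reflect (A z) (z \in s) by rewrite memA; apply: asboolP.
have [|e [Ae ee e_neq0 ef eprim]] := idempotent_refine
    (l := [seq g <- s | g * g == g]) AM id_comm _ (AX m Ad) dm dm_neq0.
  by move=> g; rewrite mem_filter => /andP[/eqP gg /sP].
have ec z : A z -> e * z = z * e by move=> Az; apply: id_comm.
have eX n : e ^+ n.+1 = e by elim: n => // n IHn; rewrite exprS IHn.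
have eMX z n : A z -> (e * z) ^+ n.+1 = e * z ^+ n.+1.
  by move=> Az; rewrite exprMn_comm ?eX //; apply: ec.
have e_nnil : ~ nilpotent_elt e.
  move=> [[|n] /eqP]; first by rewrite oner_eq0.
  by rewrite eX (negPf e_neq0).
have dichotomy z : A z -> exists n,
    e * z ^+ n.+1 = e \/ nilpotent_elt (e * z).
  move=> Az; have [[//|n] _ zn] := power_idempotent Az; exists n.
  have [|->|zn0] := eprim (z ^+ n.+1); [|by left|].
    by rewrite mem_filter zn eqxx; apply/sP/AX.
  by right; exists n.+1; rewrite eMX.
pose I : {pred R} := [pred z | (z \in s) && `[<nilpotent_elt (e * z)>]].
have IP z : reflect (A z /\ nilpotent_elt (e * z)) (z \in I).
  by rewrite inE; apply: (iffP andP) => -[/sP Az /asboolP].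
have s1 : 1 \in s by apply/sP.
have sB : {in s &, forall u v, u - v \in s}.
  by move=> u v /sP Au /sP Av; apply/sP/AB.
have sM : {in s &, forall u v, u * v \in s}.
  by move=> u v /sP Au /sP Av; apply/sP/AM.
have A0 : A 0 by rewrite -(subrr 1); apply: AB.
have I0 : 0 \in I.
  by apply/IP; split=> //; rewrite mulr0; exists 1%N; rewrite expr1.
have IB : {in I &, forall u v, u - v \in I}.
  move=> u v /IP[Au nu] /IP[Av [k vk]]; apply/IP; split; first exact: AB.
  rewrite mulrBr; have [n un] := nu; exists (n + k)%N.
  by apply: nilpotent_comm_sub un vk; apply: nil_comm => //; apply: AM.
have IMl : {in s & I, forall u v, u * v \in I}.
  move=> u v /sP Au /IP[Av nv]; apply/IP; split; first exact: AM.
  rewrite mulrA (ec u) // -mulrA -(nil_comm nv) //; last exact: AM.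
  by apply: nilM => //; apply: AM.
have IMr : {in I & s, forall u v, u * v \in I}.
  move=> u v /IP[Au nu] /sP Av; apply/IP; split; first exact: AM.
  by rewrite mulrA; apply: nilM => //; apply: AM.
have I1 : 1 \notin I by apply/IP => -[_]; rewrite mulr1.
have Iprime : {in s &, forall u v, u * v \in I -> (u \in I) || (v \in I)}.
  move=> u v /sP Au /sP Av /IP[Auv nuv]; apply/orP.
  have [n [eu|nu]] := dichotomy u Au; last by left; apply/IP.
  (* From e * u ^+ n.+1 = e, the nilpotent e * (u * v) times u ^+ n is e * v. *)
  right; apply/IP; split=> //.
  have -> : e * v = e * (u * v) * u ^+ n.
    rewrite (nil_comm nuv _ (AX n Au)); last exact: AM.
    rewrite (ec (u * v)) // !mulrA -exprSr -mulrA -(ec v) // mulrA -ec ?eu //.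
    exact: AX.
  by apply: nilM => //; [apply: AM | apply: AX].
pose K := PrimeResidue s1 sB sM I0 IB IMl IMr I1 Iprime.
have /IP[_ [k edk]] : d \in I.
  by apply: (@prime_residue_commutator _ K); apply/sP.
have [j def_m] : exists j, m = j.+1 by exists m.-1; rewrite prednK.
case: e_nnil; exists k.
by rewrite -ef def_m -eMX // -exprM mulnC exprM edk expr0n.
Qed.

(** Since [x, y] is nilpotent it commutes with x, so that x ^+ p commutes with y;
    and x differs from some x ^+ (p ^ k), k > 0, by a nilpotent, which commutes
    with y as well. *)
Lemma finite_subring_commutative p x y :
  p \in [pchar R] -> A x -> A y -> GRing.comm x y.
Proof.
move=> pR Ax Ay; set d := x * y - y * x.
have Ad : A d by apply: AB; apply: AM.
have cxd : GRing.comm x d.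
  by apply/commr_sym/nil_comm => //; apply: finite_subring_commutator_nilpotent.
have p_pr := pcharf_prime pR.
have cxpy k : GRing.comm (x ^+ (p ^ k.+1)) y.
  rewrite expnS exprM; apply/commr_sym/commrX; rewrite /GRing.comm.
  have := commutator_exprS p.-1 cxd; rewrite (prednK (prime_gt0 p_pr)) => ->.
  by rewrite mulrn_pchar // addr0.
have [|i [j [ltij eqx]]] := @finite_range_repeat _ (fun i => x ^+ (p ^ i)).
  by apply: sub_finite_set finA => _ [n _ <-]; apply: AX.
have [k def_j] : exists k, j = (k.+1 + i)%N.
  by exists (j - i).-1; rewrite prednK ?subn_gt0 // subnK // ltnW.
have nil : nilpotent_elt (x - x ^+ (p ^ k.+1)).
  exists (p ^ i)%N; rewrite (pchar_comm_sub_expr i pR) -?exprM -?expnD -?def_j.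
    by rewrite eqx subrr.
  exact/commrX.
have cny := nil_comm nil (AB Ax (AX _ Ax)) Ay.
rewrite -[x](subrK (x ^+ (p ^ k.+1))).
by apply: commr_sym; apply: commrD; apply: commr_sym.
Qed.

End FiniteSubring.

(** * Algebraic elements and torsion units *)

Section Algebra.
Variables (F : fieldType) (R : unitAlgType F).
Implicit Types (a x y : R) (r : seq R) (u v : units R).
Import GRing.Theory.
Local Open Scope ring_scope.

Lemma finite_roots (p : {poly F}) :
  p != 0 -> finite_set [set c | root p c].
Proof.
move=> p_neq0; apply: contrapT => /(infinite_set_fset (size p))[B Bp szB].
have rootB : all (root p) (finmap.enum_fset B) by apply/allP => c /Bp.
have := max_poly_roots p_neq0 rootB (finmap.fset_uniq B).
by rewrite ltnNge szB.
Qed.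

Lemma commrZ x y (k : F) : GRing.comm x y -> GRing.comm x (k *: y).
Proof. by rewrite /GRing.comm -scalerAl -scalerAr => ->. Qed.

(** The polynomial p - p(c) is a multiple of 'X - c, so a - c divides the nonzero
    scalar - p(c). *)
Lemma algebraic_sub_unit a (p : {poly F}) (c : F) :
  horner_alg a p = 0 -> p.[c] != 0 -> a - c%:A \is a GRing.unit.
Proof.
move=> pa0 pc_neq0.
have [q pE] : exists q, p - p.[c]%:P = q * ('X - c%:P).
  by apply/factor_theorem; rewrite /root !hornerE subrr.
have qa : horner_alg a q * (a - c%:A) = - p.[c]%:A.
  have := congr1 (horner_alg a) pE.
  by rewrite rmorphM !rmorphB /= pa0 sub0r !horner_algC horner_algX => ->.
have cqa : GRing.comm (horner_alg a q) (a - c%:A).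
  rewrite -[a in a - _](horner_algX a) -(horner_algC a c) -rmorphB.
  by rewrite /GRing.comm -!rmorphM mulrC.
apply/unitrP; exists (- (p.[c])^-1 *: horner_alg a q).
rewrite -scalerAl -scalerAr -cqa qa scaleNr scalerN opprK scalerA.
by rewrite mulVf // scale1r.
Qed.

(** Over an infinite field infinitely many a - c are units, so two of them
    conjugate y in the same way. *)
Lemma algebraic_comm a y :
  infinite_set [set: F] -> algebraic_elt a -> FC_subring R y -> GRing.comm a y.
Proof.
move=> infF [p p_neq0 pa0] Ny.
have infC : infinite_set [set c | p.[c] != 0].
  move=> finC; apply: infF.
  apply: (@sub_finite_set _ _ ([set c | root p c] `|` [set c | p.[c] != 0])).
    by move=> c _; case: (boolP (root p c)) => pc; [left | right].
  by rewrite finite_setU; split=> //; apply: finite_roots.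
pose g c : units R := insubd (1%g : units R) (a - c%:A).
have gE c : p.[c] != 0 -> uval (g c) = a - c%:A.
  by move=> pc; apply: (insubdK (1%g : units R)); apply: algebraic_sub_unit pc.
have [c /= pc infK] := FC_infinite_commute g infC Ny.
have [d [[/= pd cyd] dc]] : exists d, [set s | [set c | p.[c] != 0] s /\
    GRing.comm y (uval (g s) / uval (g c))] d /\ d != c.
  apply: contrapT => only_c; apply: infK.
  apply: sub_finite_set (finite_set1 c) => d Kd /=.
  by apply: contrapT => /eqP dc; apply: only_c; exists d.
have cU : a - c%:A \is a GRing.unit := algebraic_sub_unit pa0 pc.
have cd_neq0 : c - d != 0 by rewrite subr_eq0 eq_sym.
have eqq : (a - d%:A) / (a - c%:A) = 1 + (c - d) *: (a - c%:A)^-1.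
  have -> : a - d%:A = (a - c%:A) + (c - d)%:A by rewrite scalerBl addrA subrK.
  by rewrite mulrDl mulrV // -scalerAl mul1r.
rewrite gE // gE // eqq in cyd.
have cyV : GRing.comm y (a - c%:A)^-1.
  rewrite -[_^-1]scale1r -(mulVf cd_neq0) -scalerA; apply: commrZ.
  rewrite -[X in GRing.comm y X](addKr 1); apply: commrD => //.
  exact/commrN/commr1.
apply: commr_sym; rewrite -[a](subrK c%:A) -[a - _]invrK.
by apply: commrD; [apply: commrV | apply/commrZ/commr1].
Qed.

Lemma FC_subringZ x (k : F) : FC_subring R x -> FC_subring R (k *: x).
Proof.
move=> /FC_subringP finx; apply/FC_subringP.
apply: sub_finite_set (finite_image (fun z => k *: z) finx) => _ [u _ <-].
exists (uval u * x * (uval u)^-1); first by exists u.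
by rewrite -scalerAr -scalerAl.
Qed.

(** The recursion exhibits the span as finite when F is, as the image of a product
    of finite sets at each step. *)
Fixpoint lin_span r : set R :=
  if r is x :: r' then [set k *: x + z | k in [set: F] & z in lin_span r']
  else [set 0].

Lemma finite_lin_span r : finite_set [set: F] -> finite_set (lin_span r).
Proof.
by move=> finF; elim: r => [|x r IHr]; [exact: finite_set1|exact: finite_image2].
Qed.

Lemma lin_span0 r : lin_span r 0.
Proof.
elim: r => //= x r IHr; exists 0 => //; exists 0 => //.
by rewrite scale0r addr0.
Qed.

Lemma lin_spanP r k x y : lin_span r x -> lin_span r y -> lin_span r (k *: x + y).
Proof.
elim: r x y => [|z r IHr] x y /=; first by move=> -> ->; rewrite scaler0 addr0.
move=> [b _ [s rs <-]] [c _ [t rt <-]]; exists (k * b + c) => //.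
exists (k *: s + t); first exact: IHr.
by rewrite scalerDr scalerA addrACA scalerDl.
Qed.

Lemma lin_spanB r x y : lin_span r x -> lin_span r y -> lin_span r (x - y).
Proof. by move=> rx ry; rewrite addrC -scaleN1r; apply: lin_spanP. Qed.

Lemma lin_spanD r x y : lin_span r x -> lin_span r y -> lin_span r (x + y).
Proof. by move=> rx ry; rewrite -[x]scale1r; apply: lin_spanP. Qed.

Lemma lin_spanZ r k x : lin_span r x -> lin_span r (k *: x).
Proof. by move=> rx; rewrite -[_ *: x]addr0; apply: lin_spanP (lin_span0 r). Qed.

Lemma mem_lin_span r x : x \in r -> lin_span r x.
Proof.
elim: r => // z r IHr; rewrite inE => /predU1P[->|/IHr rx] /=.
  by exists 1 => //; exists 0; [exact: lin_span0 | rewrite scale1r addr0].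
by exists 0 => //; exists x; rewrite // scale0r add0r.
Qed.

Lemma lin_span_ind r (P : R -> Prop) :
  P 0 -> (forall k x y, x \in r -> P y -> P (k *: x + y)) ->
  forall x, lin_span r x -> P x.
Proof.
move=> P0; elim: r => [|z r IHr] /= PZ x; first by move=> ->.
move=> [k _ [s rs <-]]; apply: (PZ); first exact: mem_head.
by apply: IHr rs => c t w rt; apply: PZ; rewrite inE rt orbT.
Qed.

Lemma lin_spanM r :
  {in r &, forall x y, x * y \in r} ->
  forall x y, lin_span r x -> lin_span r y -> lin_span r (x * y).
Proof.
move=> rM x y rx ry; elim/lin_span_ind: rx.
  by rewrite mul0r; apply: lin_span0.
move=> k z x' rz IHx; rewrite mulrDl -scalerAl; apply: lin_spanP => //.
elim/lin_span_ind: ry {IHx}; first by rewrite mulr0; apply: lin_span0.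
move=> c t y' rt IHy; rewrite mulrDr -scalerAr; apply: lin_spanP => //.
exact/mem_lin_span/rM.
Qed.

(** Modulo p each power of 'X reduces to a polynomial of smaller size than p. *)
Lemma algebraic_finite_powers a :
  finite_set [set: F] -> algebraic_elt a ->
  finite_set (range (fun n => a ^+ n)).
Proof.
move=> finF [p p_neq0 pa0].
pose r := [seq a ^+ i | i <- iota 0 (size p)].
apply: sub_finite_set (finite_lin_span r finF) => _ [n _ <-].
have -> : a ^+ n = horner_alg a ('X^n %% p).
  rewrite -[in LHS](horner_algX a) -rmorphXn {1}(divp_eq 'X^n p).
  by rewrite rmorphD rmorphM /= pa0 mulr0 add0r.
rewrite -[_ %% _]coefK poly_def rmorph_sum /=.
apply: big_ind => [||i _]; [exact: lin_span0 | exact: lin_spanD |].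
rewrite -mul_polyC rmorphM rmorphXn /= horner_algC horner_algX mulr_algl.
apply/lin_spanZ/mem_lin_span.
apply: map_f; rewrite mem_iota /= add0n.
by rewrite (leq_trans (ltn_ord i)) // ltnW // ltn_modp.
Qed.

End Algebra.

(** * The FC-radical *)

Section Radical.
Variables (F : fieldType) (R : unitAlgType F) (H : set (units R)).
Hypothesis omegaH : omega_subgroup H.
Implicit Types u v : units R.
Import GRing.Theory.

Lemma torsion_algebraic u n :
  (0 < n)%N -> (u ^+ n = 1)%g -> algebraic_elt (uval u).
Proof.
move=> n_gt0 un; exists ('X^n - 1)%R.
  by rewrite -size_poly_eq0 size_XnsubC.
rewrite rmorphB rmorphXn /= horner_algX rmorph1.
have -> : (uval u ^+ n = uval (u ^+ n)%g)%R.
  by elim: (n) => [|k IHk] //; rewrite exprS expgS IHk.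
by rewrite un /= subrr.
Qed.

(** Over an infinite field u is algebraic, hence commutes with v.  Over a
    finite field the two units lie in the linear span of a finite monoid of
    units, a finite subring of prime characteristic. *)
Lemma torsion_FC_radical_commute u v :
  torsion (FC_radical R) u -> torsion (FC_radical R) v -> commute u v.
Proof.
move=> [Nu [m [m_gt0 um]]] [Nv [n [n_gt0 vn]]]; apply: commute_uval.
have [finF|infF] := pselect (finite_set [set: F]); last first.
  exact: algebraic_comm infF (torsion_algebraic m_gt0 um) Nv.
have fu := (FC_radicalP u).1 Nu; have fv := (FC_radicalP v).1 Nv.
have [V [finV V1 Vu Vv VM]] := torsion_finite_submonoid fu fv m_gt0 n_gt0 um vn.
have [r rE] : exists r : seq R,
    (@uval R) @` (V `&` [set w | finite_class w]) = [set` r].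
  exact: (finite_seqP _).1 (finite_image _ (finite_setIl _ finV)).
have rP w : V w -> finite_class w -> uval w \in r.
  move=> Vw fw; suff : [set` r] (uval w) by [].
  by rewrite -rE; exists w.
have rV x : x \in r -> exists w, [/\ V w, finite_class w & uval w = x].
  move=> rx; have : [set` r] x by [].
  by rewrite -rE => -[w [Vw fw] <-]; exists w.
have rM : {in r &, forall x y, x * y \in r}%R.
  move=> _ _ /rV[w [Vw fw <-]] /rV[z [Vz fz <-]].
  by apply: (rP (w * z)%g); [apply: VM | apply: finite_classM].
have spanN : lin_span (F := F) r `<=` FC_subring R.
  apply: lin_span_ind => [|k _ y /rV[w [_ fw <-]] Ny]; first exact: FC_subring0.
  apply: FC_subringD => //.
  by apply/FC_subringZ/FC_radicalP.
have r1 : (1%R : R) \in r.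
  by apply: (rP 1%g) => //; apply/FC_radicalP/FC_subring1.
have [k k_gt0 k0] : exists2 k, (0 < k)%N & (k%:R == 0 :> F)%R.
  have [|i [j [ltij eqij]]] := @finite_range_repeat _ (fun i => i%:R : F)%R.
    exact: sub_finite_set finF.
  by exists (j - i)%N; rewrite ?subn_gt0 // natrB ?(ltnW ltij) // eqij subrr.
have [p pF] := natf0_pchar k_gt0 k0.
have chR : p \in [pchar R]%R by rewrite pchar_lalg.
apply: (finite_subring_commutative omegaH (finite_lin_span r finF) _ _ _ _ chR).
- exact: mem_lin_span.
- exact: lin_spanB.
- exact: lin_spanM.
- exact: spanN.
- exact/mem_lin_span/rP.
- exact/mem_lin_span/rP.
Qed.

Lemma algebraic_FC_radical_commute u v :
  (forall a : R, FC_subring R a -> algebraic_elt a) ->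
  FC_radical R u -> FC_radical R v -> commute u v.
Proof.
move=> alg Nu Nv.
have [finF|infF] := pselect (finite_set [set: F]); last first.
  by apply: commute_uval; apply: algebraic_comm => //; apply: alg.
have tors w : FC_radical R w -> torsion (FC_radical R) w.
  move=> Nw; split=> //; apply: finite_powers_torsion.
  have finX := algebraic_finite_powers finF (alg _ Nw).
  apply: sub_finite_set (finite_image (insubd (1%g : units R)) finX).
  move=> _ [n _ <-]; exists (uval w ^+ n)%R; first by exists n.
  rewrite -[RHS](valKd (1%g : units R)); congr (insubd _ _).
  by elim: n => [|n IHn] //; rewrite exprS expgS IHn.
by apply: torsion_FC_radical_commute; apply: tors.
Qed.

End Radical.

Theorem theorem2 (F : fieldType) (R : unitAlgType F)
    (HR : exists H : set (units R), omega_subgroup H) :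
  [/\ forall u : units R,
        commutator_subgroup (torsion (FC_radical R)) (torsion (FC_radical R)) u ->
        unipotent u /\ center (FC_radical R) u,
      (forall a : R, FC_subring R a -> algebraic_elt a) ->
        nilpotent_class_at_most 2 (FC_radical R)
    & solvable_length_at_most 3 (FC_radical R) /\
        nilpotent_class_at_most 2 (torsion (FC_radical R))].
Proof.
have [H omegaH] := HR.
have t' := commutator_subgroup_trivial (torsion_FC_radical_commute omegaH).
have trivial1 (A : set (units R)) : commutator_subgroup [set 1%g] A = [set 1%g].
  by apply: commutator_subgroup_trivial => _ x -> _; apply/commute_sym/commute1.
split.
- move=> u; rewrite t' => ->; split.
    by exists 0%R; split; [exists 1%N; rewrite GRing.expr1 | rewrite GRing.addr0].
  by split; [exact: FC_subring1 | move=> x _; apply: commute1].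
- move=> alg; rewrite /nilpotent_class_at_most /=.
  rewrite (commutator_subgroup_trivial (A := FC_radical R)) //.
  by move=> u v; apply: (algebraic_FC_radical_commute omegaH).
split; last by rewrite /nilpotent_class_at_most /= t'.
rewrite /solvable_length_at_most /=.
rewrite (_ : commutator_subgroup (commutator_subgroup (FC_radical R) _) _
  = [set 1%g]) //.
apply: commutator_subgroup_trivial => u v Du Dv.
apply: (torsion_FC_radical_commute omegaH); exact: FC_radical_derived.
Qed.
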